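(* Let $a$ be an integer and let $n$ be a positive odd integer. Then, for an indeterminate $q$ (equivalently, for every complex number $q\neq 0,1$), $$\det\left[\left[\left\lfloor\frac{aj-(a+1)k}{n}\right\rfloor\right]_q\right]_{1\leqslant j,k\leqslant n}=-\left(\frac{a(a+1)}{n}\right)q^{(1-3n)/2}.$$
   Context: For an integer $m$, its $q$-analogue is $[m]_q=(1-q^m)/(1-q)$ (so $[m]_q=-q^m(1-q^{-m})/(1-q)$ for negative $m$). $\lfloor x\rfloor$ denotes the largest integer not exceeding $x$. $\left(\frac{\cdot}{n}\right)$ denotes the Jacobi symbol modulo the positive odd integer $n$ (equal to $0$ when the argument is not coprime to $n$, and $\left(\frac{\cdot}{1}\right)=1$). *)

(* Defs.v *)
From HB Require Import structures.
From mathcomp Require Import all_boot all_order all_algebra.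
Set Implicit Arguments. Unset Strict Implicit. Unset Printing Implicit Defensive.
Import Order.TTheory GRing.Theory Num.Theory.
Local Open Scope ring_scope.

Definition qint (R : fieldType) (q : R) (m : int) : R := (1 - q ^ m) / (1 - q).

Definition legendre (a : int) (p : nat) : int :=
  if (p%:Z %| a)%Z then 0
  else if [exists x : 'I_p, (p%:Z %| (x%:Z ^+ 2 - a))%Z] then 1 else -1.

Definition jacobi (a : int) (n : nat) : int :=
  \prod_(p <- primes n) legendre a p ^+ logn p n.

(* Main.v *)
(** Write [a j = A_j n + r_j] and [(a + 1) k = B_k n + s_k] with residues [r_j],
    [s_k] in [[0, n)], so that the floor is [A_j - B_k - [r_j < s_k]].

    If a prime [p] divides [n] and [a], three rows at distance [n / p] satisfy a
    linear recurrence of order two, so the determinant vanishes; the same holds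
    for columns if [p] divides [a + 1].

    Otherwise [j |-> r_j] and [k |-> s_k] are permutations whose signs are Jacobi
    symbols (Zolotarev's theorem).  After permuting rows and columns and scaling
    by powers of [q], the matrix becomes a rank-one matrix minus the threshold
    matrix with entries [q^-1] above the diagonal and [1] elsewhere.  The latter
    has determinant [(1 - q^-1)^(n-1)], and the matrix determinant lemma leaves
    a scalar factor which is a telescoping sum.

    Zolotarev's theorem is proved for all affine maps [x |-> a x + b] modulo an
    odd [n], because affine maps are what the digit decomposition
    [Z/mn = Z/m * Z/n] produces on the fibers; for a prime modulus the
    Vandermonde determinant of [0, ..., p-1] turns the sign into Euler's
    criterion. *)
Require Import Defs.
From HB Require Import structures.
From mathcomp Require Import all_boot all_order all_algebra.
From mathcomp Require Import all_fingroup all_solvable all_field.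
From mathcomp Require Import zify ring.
Import Order.TTheory GRing.Theory Num.Theory.
Local Open Scope ring_scope.

(** * Signs of permutations *)

(** The transposition of [x] and [y] becomes that of [f x] and [f y], so a factorisation of [s] into
    transpositions yields one of [t] of the same length. *)
Lemma odd_perm_inj (T T' : finType) (f : T -> T') (s : {perm T})
    (t : {perm T'}) :
    injective f -> (forall x, t (f x) = f (s x)) ->
    (forall z, z \notin codom f -> t z = z) ->
  odd_perm t = odd_perm s.
Proof.
move=> f_inj; have [ts -> _] := prod_tpermP s.
elim: ts t => [|[x y] ts IHts] t tf tid.
  rewrite big_nil odd_perm1; have -> : t = 1%g; last exact: odd_perm1.
  apply/permP=> z; rewrite perm1; case: (boolP (z \in codom f)) => [|/tid//].
  by case/codomP=> u ->; rewrite tf big_nil perm1.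
rewrite big_cons odd_permM -(IHts (tperm (f x) (f y) * t)%g) => [|u|z zNf].
- by rewrite odd_permM !odd_tperm (inj_eq f_inj) addKb.
- by rewrite permM -inj_tperm // tf big_cons permM tpermK.
- have zNf1 v : f v != z by apply: contra zNf => /eqP <-; apply: codom_f.
  by rewrite permM tpermD // tid.
Qed.

Lemma odd_perm_fiberwise (X Y : finType) (s : X -> {perm Y})
    (t : {perm X * Y}) :
    (forall x y, t (x, y) = (x, s x y)) ->
  (-1) ^+ odd_perm t = \prod_x (-1) ^+ odd_perm (s x) :> int.
Proof.
move=> ts; rewrite -big_enum /=.
(* Generalised for induction: [t] acts only on the fibers over a list of base points; [e] is its
   action on the fiber over the head. *)
have: forall x y, t (x, y) = (x, if x \in enum X then s x y else y).
  by move=> x y; rewrite mem_enum inE.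
elim: (enum X) (enum_uniq X) t {ts} => [_|x l IHl /andP[xNl ul]] t ts.
  rewrite big_nil; suff -> : t = 1%g by rewrite odd_perm1.
  by apply/permP=> -[x y]; rewrite ts perm1.
pose e z : X * Y := if z.1 == x then (x, s x z.2) else z.
have e_inj : injective e.
  move=> [x1 y1] [x2 y2]; rewrite /e /=.
  case: (eqVneq x1 x) => [->|x1x]; case: (eqVneq x2 x) => [->|x2x] //.
  - by case=> /perm_inj ->.
  - by case=> x2E; rewrite x2E eqxx in x2x.
  - by case=> x1E; rewrite x1E eqxx in x1x.
have -> : t = ((perm e_inj) * ((perm e_inj)^-1 * t))%g by rewrite mulKVg.
rewrite odd_permM signr_addb big_cons; congr (_ * _).
  congr (_ ^+ nat_of_bool _); apply: (@odd_perm_inj _ _ (pair x)).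
  - by move=> ? ? [].
  - by move=> y; rewrite permE /e /= eqxx.
  - move=> [x' y'] x'P; rewrite permE /e /=; case: eqP => // x'x.
    by case/negP: x'P; rewrite x'x; apply: codom_f.
apply: IHl => // x' y'; rewrite permM.
case: (eqVneq x' x) => [->|x'x].
  have -> : ((perm e_inj)^-1)%g (x, y') = (x, ((s x)^-1)%g y').
    by apply: (@perm_inj _ (perm e_inj)); rewrite permKV permE /e /= eqxx permKV.
  by rewrite ts mem_head (negPf xNl) permKV.
have -> : ((perm e_inj)^-1)%g (x', y') = (x', y').
  by apply: (@perm_inj _ (perm e_inj)); rewrite permKV permE /e /= (negPf x'x).
by rewrite ts in_cons (negPf x'x).
Qed.

(** The unit group is cyclic, generated by [g] of order |F| - 1. If a = g^k, the hypothesis makes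
    |F| - 1 divide k (|F| - 1) / 2, so k is even. *)
Lemma square_of_euler (F : finFieldType) (a : F) : odd #|F| -> a != 0 ->
  a ^+ #|F|.-1./2 = 1 -> exists x, a = x ^+ 2.
Proof.
move=> oddF a0 ah.
have [g gP] := cyclicP (field_unit_group_cyclic [set: {unit F}]).
have oG : #[g]%g = #|F|.-1 by rewrite orderE -gP card_finField_unit.
have aU : a \is a GRing.unit by rewrite unitfE.
pose u : {unit F} := FinRing.Unit aU.
have /cycleP[k uk] : u \in <[g]>%g by rewrite -gP inE.
have F0 : (0 < #|F|)%N by apply/card_gt0P; exists 0.
have F1 : (1 < #|F|)%N by apply: finNzRing_gt1.
have : (#[g]%g %| k * #|F|.-1./2)%N.
  rewrite order_dvdn expgM -uk; apply/eqP/val_inj.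
  by rewrite /= FinRing.val_unitX /= ah.
have -> : #[g]%g = (2 * #|F|.-1./2)%N.
  by rewrite oG mul2n -[LHS]odd_double_half -subn1 oddB // oddF.
rewrite dvdn_pmul2r; last by case: #|F| oddF F1 => [|[|[|]]].
case/dvdnP=> l kl; exists (val (g ^+ l)%g).
by rewrite -FinRing.val_unitX -expgM -kl -uk.
Qed.

Definition is_affine_perm (n : nat) (a b : int) (s : 'S_n) :=
  forall j : 'I_n, (n%:Z %| (s j)%:Z - (a * j%:Z + b))%Z.

Lemma ord_eq_dvdz (n : nat) (i j : 'I_n) : (n%:Z %| i%:Z - j%:Z)%Z -> i = j.
Proof.
rewrite -eqz_mod_dvd !modz_small ?ltz_nat ?ltn_ord ?lez_nat //=.
by move=> /eqP[] /ord_inj.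
Qed.

Lemma affine_perm_exists (n : nat) (a b : int) : coprimez n a ->
  exists s : 'S_n, is_affine_perm n a b s.
Proof.
case: n => [|n] an; first by exists 1%g; case.
have modP (z : int) : (`|(z %% n.+1%:Z)%Z| < n.+1)%N.
  by rewrite -ltz_nat gez0_abs ?modz_ge0 ?ltz_pmod.
pose f (j : 'I_n.+1) : 'I_n.+1 := Ordinal (modP (a * j%:Z + b)).
have fP j : (n.+1%:Z %| (f j)%:Z - (a * j%:Z + b))%Z.
  by rewrite /= gez0_abs ?modz_ge0 // -eqz_mod_dvd modz_mod.
have f_inj : injective f.
  move=> i j fij; apply: ord_eq_dvdz.
  rewrite -(Gauss_dvdzr _ an) (_ : a * _ =
    (f j)%:Z - (a * j%:Z + b) - ((f i)%:Z - (a * i%:Z + b))).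
    by apply: rpredB; apply: fP.
  by rewrite fij; ring.
by exists (perm f_inj) => j; rewrite permE.
Qed.

Lemma affine_perm_comp (n : nat) (a b c d : int) (s t : 'S_n) :
  is_affine_perm n a b s -> is_affine_perm n c d t ->
  is_affine_perm n (c * a) (c * b + d) (s * t)%g.
Proof.
move=> hs ht j; rewrite permM.
rewrite (_ : _ - _ = (t (s j))%:Z - (c * (s j)%:Z + d)
   + c * ((s j)%:Z - (a * j%:Z + b))); last by ring.
by rewrite rpredD // dvdz_mull.
Qed.

(** Permuting the columns of the Vandermonde matrix multiplies its determinant by the sign; it also
    replaces each node j by a j + b, which multiplies each of the p (p - 1) / 2 differences by [a].
    Fermat's a^p = a removes the factor p from the exponent. *)
Lemma sign_affine_perm_euler (p : nat) (a b : int) (s : 'S_p) :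
    prime p -> odd p -> coprimez p a -> is_affine_perm p a b s ->
  (-1) ^+ odd_perm s = a%:~R ^+ p.-1./2 :> 'F_p.
Proof.
move=> p_pr p_odd pa hs.
have p0 := prime_gt0 p_pr.
pose v : 'rV['F_p]_p := \row_j j%:R.
have dV : \det (Vandermonde p v) != 0.
  rewrite det_Vandermonde; apply/prodf_neq0 => i _; apply/prodf_neq0 => j ij.
  rewrite !mxE -[j%:R]/(j%:~R) -[i%:R]/(i%:~R) -intrB.
  rewrite -(dvdz_pcharf (pchar_Fp p_pr)); apply: contraTN ij => /ord_eq_dvdz ->.
  by rewrite ltnn.
apply: (mulIf dV).
have sE : col_perm s (Vandermonde p v) = Vandermonde p (\row_j (v 0 (s j))).
  by apply/matrixP=> i j; rewrite !mxE.
have -> : (-1) ^+ odd_perm s * \det (Vandermonde p v) =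
   \det (col_perm s (Vandermonde p v)).
  by rewrite col_permE det_mulmx det_perm odd_permV mulrC.
rewrite sE !det_Vandermonde.
have -> : a%:~R ^+ p.-1./2 = \prod_(i < p) \prod_(j < p | (i < j)%N) a%:~R :> 'F_p.
  rewrite (exchange_big_dep predT) //=.
  under eq_bigr => j _ do
    rewrite (big_ord_narrow (ltnW (ltn_ord j))) prodr_const card_ord.
  rewrite -expr_sum -(big_mkord predT id) bin2_sum bin2.
  rewrite (_ : (p * p.-1)./2 = p * p.-1./2)%N; last first.
    rewrite -[in LHS](odd_double_half p.-1) -subn1 oddB // p_odd add0n.
    by rewrite -doubleMr doubleK.
  by rewrite exprM -[X in _ ^+ X ^+ _](card_Fp p_pr) expf_card.
rewrite -big_split; apply: eq_bigr => i _.
rewrite -big_split; apply: eq_bigr => j _; rewrite !mxE /=.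
have vs (k : 'I_p) : (s k)%:R = a%:~R * k%:R + b%:~R :> 'F_p.
  rewrite -[k%:R]/(k%:~R) -[(s k)%:R]/((s k)%:~R); apply/eqP.
  by rewrite -intrM -intrD -subr_eq0 -intrB -(dvdz_pcharf (pchar_Fp p_pr)).
by rewrite !vs; ring.
Qed.

Lemma sign_affine_perm_legendre (p : nat) (a b : int) (s : 'S_p) :
    prime p -> odd p -> coprimez p a -> is_affine_perm p a b s ->
  (-1) ^+ odd_perm s = legendre a p.
Proof.
move=> p_pr p_odd pa hs; have p0 := prime_gt0 p_pr.
have euler := sign_affine_perm_euler p a b s p_pr p_odd pa hs.
have dvdF := dvdz_pcharf (pchar_Fp p_pr).
have paN : ~~ (p%:Z %| a)%Z.
  by rewrite dvdzE -prime_coprime // -coprimezE.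
have a0 : a%:~R != 0 :> 'F_p by rewrite -dvdF.
rewrite /legendre (negPf paN).
have sqP (x : 'I_p) : (p%:Z %| x%:Z ^+ 2 - a)%Z = (a%:~R == x%:R ^+ 2 :> 'F_p).
  by rewrite dvdF intrB rmorphXn /= subr_eq0 eq_sym.
have ph : p.-1 = (2 * p.-1./2)%N.
  by rewrite mul2n -[LHS]odd_double_half -subn1 oddB // p_odd.
case: existsP => [[x]|sqN].
  rewrite sqP => /eqP ax; case: (odd_perm s) euler => //.
  have x0 : x%:R != 0 :> 'F_p by apply: contraNneq a0 => x0; rewrite ax x0 expr0n.
  rewrite ax -exprM -ph => /eqP; rewrite (_ : _ ^+ p.-1 = 1).
    rewrite expr1 -subr_eq0 -opprD oppr_eq0 -(natrD _ 1 1) -(dvdn_pcharf (pchar_Fp p_pr)).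
    by rewrite dvdn_prime2 // => /eqP p2; rewrite p2 in p_odd.
  apply: (mulIf x0); rewrite mul1r -exprSr prednK //.
  by rewrite -[X in _ ^+ X](card_Fp p_pr) expf_card.
case: (odd_perm s) euler => //= /esym ah; case: sqN.
have [|||y ay] := @square_of_euler _ (a%:~R : 'F_p); rewrite ?card_Fp //.
have yp : (y < p)%N by rewrite -[X in (_ < X)%N](Fp_cast p_pr) ltn_ord.
by exists (Ordinal yp); rewrite sqP ay /= natr_Zp.
Qed.

(** * Zolotarev's theorem *)

(** A common index range lets the symbols modulo [m], [n] and [m * n] be compared factor by factor;
    the added indices have exponent 0. *)
Lemma jacobi_widen (a : int) (n N : nat) : (0 < n < N)%N ->
  jacobi a n = \prod_(p <- iota 0 N) legendre a p ^+ logn p n.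
Proof.
case/andP=> n0 nN; rewrite /jacobi.
rewrite [in RHS](bigID (mem (primes n)) predT) /= [X in _ * X]big1 ?mulr1.
  rewrite -[in RHS]big_filter; apply: perm_big; apply: uniq_perm.
  - exact: primes_uniq.
  - by rewrite filter_uniq // iota_uniq.
  move=> p; rewrite mem_filter mem_iota /= add0n.
  case: (boolP (p \in primes n)) => //=; rewrite mem_primes => /and3P[_ _ pn].
  by rewrite (leq_ltn_trans _ nN) // dvdn_leq.
by move=> p pn; rewrite -logn_gt0 -eqn0Ngt in pn; rewrite (eqP pn) expr0.
Qed.

Lemma jacobi_mul_modulus (a : int) (m n : nat) : (0 < m)%N -> (0 < n)%N ->
  jacobi a (m * n) = jacobi a m * jacobi a n.
Proof.
move=> m0 n0; pose N := (m * n).+1.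
rewrite !(@jacobi_widen a _ N); last 3 first.
- by rewrite n0 ltnS leq_pmull.
- by rewrite m0 ltnS leq_pmulr.
- by rewrite muln_gt0 m0 n0 ltnSn.
rewrite -big_split; apply: eq_bigr => p _.
by rewrite lognM // exprD.
Qed.

Lemma jacobi_prime (a : int) (p : nat) : prime p -> jacobi a p = legendre a p.
Proof.
by move=> p_pr; rewrite /jacobi primes_prime // big_seq1 logn_prime // eqxx.
Qed.

Definition zolotarev_at (n : nat) := forall (a b : int) (s : 'S_n),
  coprimez n a -> is_affine_perm n a b s -> (-1) ^+ odd_perm s = jacobi a n.

(** Write an index as x + m y. The low digit moves by an affine map [u] modulo [m]; over each fixed
    x the high digit moves by an affine map modulo [n]. The [m] fiber signs and the [n] copies of
    the sign of [u] give odd powers of the two symbols. *)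
Lemma zolotarev_mul (m n : nat) : odd m -> odd n ->
  zolotarev_at m -> zolotarev_at n -> zolotarev_at (m * n).
Proof.
move=> m_odd n_odd zm zn a b s; rewrite PoszM coprimezMl => /andP[ma na] hs.
have m0 := odd_gt0 m_odd; have n0 := odd_gt0 n_odd.
have [u hu] := affine_perm_exists m a b ma.
(* The shift of [v x] is the carry from the low digit. *)
have [v hv] := fin_all_exists (fun x : 'I_m => affine_perm_exists n a
  ((a * x%:Z + b - (u x)%:Z) %/ m%:Z)%Z na).
pose t1 (z : 'I_m * 'I_n) := (z.1, v z.1 z.2).
have t1_inj : injective t1.
  by move=> [x y] [x' y'] [/= -> /perm_inj ->].
pose t2 (z : 'I_m * 'I_n) := (u z.1, z.2).
have t2_inj : injective t2.
  by move=> [x y] [x' y'] [/= /perm_inj -> ->].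
pose t2' (z : 'I_n * 'I_m) := (z.1, u z.2).
have t2'_inj : injective t2'.
  by move=> [x y] [x' y'] [/= -> /perm_inj ->].
(* The symbol is a permutation sign, hence 1 or -1, and an odd power does not change it. *)
have powE c k : odd k -> zolotarev_at c ->
    coprimez c a -> jacobi a c ^+ k = jacobi a c.
  move=> k_odd zc ca; have [e he] := affine_perm_exists c a 0 ca.
  rewrite -(zc _ _ _ ca he); case: (odd_perm e); rewrite ?expr1n //.
  by rewrite expr1 -signr_odd k_odd.
pose t := (perm t1_inj * perm t2_inj)%g.
have fP (z : 'I_m * 'I_n) : (z.1 + m * z.2 < m * n)%N.
  case: z => x y /=; have := ltn_ord x; have := ltn_ord y; nia.
pose f z := Ordinal (fP z).
have f_inj : injective f.
  move=> [x y] [x' y'] [/= e].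
  have := ltn_ord x; have := ltn_ord x'.
  move=> x'm xm.
  have ex : x = x' :> nat.
    move/(congr1 (modn^~ m)): e.
    by rewrite ![(_ + m * _)%N]addnC ![(m * _)%N]mulnC !modnMDl !modn_small.
  rewrite -ex in e; move/addnI/eqP: e.
  by rewrite eqn_pmul2l // => /eqP/ord_inj ->; move/ord_inj: ex => ->.
have f_surj z : z \in codom f.
  by apply: inj_card_onto => //; rewrite card_prod !card_ord.
have -> : odd_perm s = odd_perm t.
  apply: (@odd_perm_inj _ _ f) => // [[x y]|z]; last by rewrite f_surj.
  apply: ord_eq_dvdz.
  rewrite !permM !permE /t1 /t2 /=.
  have /dvdzP[k hk] := hs (f (x, y)).
  have /dvdzP[l hl] := hu x.
  have /dvdzP[r hr] := hv x y.
  have hc : (a * x%:Z + b - (u x)%:Z) = - l * m by rewrite mulNr -hl; ring.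
  rewrite hc mulzK in hr; last by lia.
  apply/dvdzP; exists (k - r).
  rewrite [RHS](_ : _ = k * (m * n)%N%:Z - l * m%:Z - m%:Z * (r * n%:Z) + l * m%:Z);
    last by rewrite PoszM; ring.
  by rewrite -hk -{1}hl -hr /= !PoszD !PoszM; ring.
rewrite odd_permM signr_addb jacobi_mul_modulus // mulrC; congr (_ * _).
  (* Swapping the coordinates makes [u] act fiberwise too. *)
  have -> : odd_perm (perm t2_inj) = odd_perm (perm t2'_inj).
    apply: (@odd_perm_inj _ _ (fun z => (z.2, z.1))) => [[? ?] [? ?] []||].
    - by move=> -> ->.
    - by case=> y x; rewrite !permE.
    - by move=> [x y] /codomP[]; exists (y, x).
  rewrite (@odd_perm_fiberwise _ _ (fun=> u)); last by move=> x y; rewrite permE.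
  by rewrite (zm _ _ _ ma hu) prodr_const card_ord powE.
rewrite (@odd_perm_fiberwise _ _ v); last by move=> x y; rewrite permE.
under eq_bigr => x _ do rewrite (zn _ _ _ na (hv x)).
by rewrite prodr_const card_ord powE.
Qed.

Theorem zolotarev (n : nat) : odd n -> zolotarev_at n.
Proof.
elim/ltn_ind: n => n IHn n_odd; have n0 := odd_gt0 n_odd.
have [n1|n1] := leqP n 1.
  have {n1 IHn n0 n_odd} -> : n = 1%N by lia.
  move=> a b s _ _; rewrite /jacobi big_nil (_ : s = 1%g) ?odd_perm1 //.
  by apply/permP=> x; rewrite !ord1.
have p_pr := pdiv_prime n1; have /dvdnP[m nE] := pdiv_dvd n.
have mn : odd m && odd (pdiv n) by rewrite -oddM -nE.
case/andP: mn => m_odd p_odd; rewrite nE; apply: zolotarev_mul => //.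
  by apply: IHn => //; rewrite [X in (_ < X)%N]nE ltn_Pmulr ?prime_gt1 // odd_gt0.
move=> a b s pa hs; rewrite jacobi_prime //.
exact: sign_affine_perm_legendre hs.
Qed.

(** * Threshold matrices *)

(** Two block triangular factorisations of the same bordered matrix give det(1 - w b) = 1 - b w. *)
Lemma det_rank1_sub1 (R : comNzRingType) (n : nat) (w : 'cV[R]_n) (b : 'rV[R]_n) :
  \det (w *m b - 1%:M) = (-1) ^+ n * (1 - (b *m w) 0 0).
Proof.
rewrite -opprB -scaleN1r detZ; congr (_ * _).
have -> : 1 - (b *m w) 0 0 = \det (1%:M - b *m w) by rewrite det_mx11 !mxE eqxx.
transitivity (\det (block_mx 1%:M w b (1%:M : 'M_1))).
  have -> : block_mx 1%:M w b 1%:M =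
      block_mx (1%:M - w *m b) w 0 1%:M *m block_mx 1%:M 0 b (1%:M : 'M_1).
    by rewrite mulmx_block !mulmx1 !mul0mx mul1mx !add0r mulmx0 add0r subrK.
  by rewrite det_mulmx det_ublock det_lblock !det1 !mulr1.
have -> : block_mx 1%:M w b 1%:M =
    block_mx 1%:M 0 b 1%:M *m block_mx 1%:M w 0 (1%:M - b *m w).
  by rewrite mulmx_block !mulmx1 !mul0mx mul1mx !addr0 mulmx0 addr0 mul1mx addrC subrK.
by rewrite det_mulmx det_ublock det_lblock !det1 !mul1r.
Qed.

Definition threshold_mx (R : nzRingType) (x : R) (m : nat) : 'M[R]_m.+1 :=
  \matrix_(r, s) (if (r < s)%N then x else 1).

Lemma det_threshold_mx (R : comNzRingType) (x : R) (m : nat) :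
  \det (threshold_mx R x m) = (1 - x) ^+ m.
Proof.
(* [L] takes partial sums of rows; [D] holds the first row (1, x, ..., x) and the differences of
   successive rows, so it is upper triangular. *)
pose L : 'M[R]_m.+1 := \matrix_(r, s) (s <= r)%N%:R.
pose D : 'M[R]_m.+1 := \matrix_(r, s)
  if r == 0 then (if s == 0 then 1 else x) else (1 - x) *+ (r == s).
have -> : threshold_mx R x m = L *m D.
  apply/matrixP=> r s; rewrite !mxE big_ord_recl !mxE /= mul1r.
  have [->|s0] := eqVneq s 0.
    by rewrite ltn0 big1 ?addr0 // => i _; rewrite !mxE /= mulr0.
  have [s' ->] : exists s' : 'I_m, s = lift ord0 s'.
    by case: (unliftP ord0 s) s0 => [s' -> _|->]; [exists s' | rewrite eqxx].
  rewrite (bigD1 s') //= big1 => [|i is']; last first.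
    by rewrite !mxE /= (inj_eq lift_inj) (negPf is') mulr0n mulr0.
  rewrite !mxE /= eqxx addr0 ltnNge.
  by case: (_ <= _)%N; rewrite ?mul1r ?mul0r /=; ring.
rewrite det_mulmx det_trig; last first.
  by apply/is_trig_mxP => i j ij; rewrite mxE leqNgt ij.
rewrite big1 ?mul1r => [|i _]; last by rewrite mxE leqnn.
rewrite -det_tr det_trig; last first.
  apply/is_trig_mxP => i j ij; rewrite !mxE.
  case: eqVneq => [j0|_]; first by rewrite j0 in ij.
  by case: eqVneq => // ji; rewrite ji ltnn in ij.
rewrite big_ord_recl !mxE /= mul1r.
under eq_bigr do rewrite !mxE /= eqxx.
by rewrite prodr_const card_ord.
Qed.

(* The bracket is the cyclic difference of [f], twisted by [x] on wrapping
   around: [threshold_mx] inverts it up to the factor [1 - x]. *)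
Lemma threshold_mx_solve (R : comNzRingType) (x : R) (m : nat) (f : nat -> R)
    (r : 'I_m.+1) :
  \sum_s threshold_mx R x m r s * (f s - (if s == 0 then x * f m else f s.-1))
  = (1 - x) * f r.
Proof.
pose d (s : nat) := f s - (if s == 0%N then x * f m else f s.-1).
have dE k : \sum_(s < k.+1) d s = f k - x * f m.
  elim: k => [|k IHk]; first by rewrite big_ord1.
  by rewrite big_ord_recr IHk /d /=; ring.
(* Row [r] has entries x + (1 - x) [s <= r], so only the full sum and one partial sum of [d] are
   needed, and both telescope. *)
have -> : \sum_s threshold_mx R x m r s * (f s - (if s == 0 then x * f m else f s.-1))
   = x * \sum_(s < m.+1) d s + (1 - x) * \sum_(s < r.+1) d s.
  rewrite (big_ord_widen _ d (ltn_ord r)) [X in _ + _ * X]big_mkcond.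
  rewrite !mulr_sumr -big_split /=.
  apply: eq_bigr => s _; rewrite /= mxE -[s == 0]/(s == 0%N :> nat) -/(d s) ltnS ltnNge.
  by case: (s <= r)%N => /=; ring.
by rewrite !dE; ring.
Qed.

(** Factor the threshold matrix T out on the left: f g - T = T (w g - 1), where T w = f is solved by
    [threshold_mx_solve]. *)
Lemma det_rank1_sub_threshold (F : fieldType) (x : F) (m : nat) (f : nat -> F)
    (g : 'I_m.+1 -> F) : x != 1 ->
  \det (\matrix_(r < m.+1, s < m.+1) (f r * g s - threshold_mx F x m r s)) =
  (-1) ^+ m.+1 * (1 - x) ^+ m *
  (1 - (1 - x)^-1 *
       \sum_s g s * (f s - (if s == 0 then x * f m else f s.-1))).
Proof.
move=> x1; have x1' : 1 - x != 0 by rewrite subr_eq0 eq_sym.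
pose w : 'cV_m.+1 := \col_s ((1 - x)^-1 * (f s - (if s == 0 then x * f m else f s.-1))).
pose b : 'rV_m.+1 := \row_s g s.
have -> : \matrix_(r, s) (f r * g s - threshold_mx F x m r s)
    = threshold_mx F x m *m (w *m b - 1%:M).
  rewrite mulmxBr mulmx1 mulmxA; apply/matrixP=> r s.
  rewrite [LHS]mxE [RHS]mxE [X in _ = _ + X]mxE; congr (_ - _).
  rewrite [RHS]mxE big_ord1 [b _ _]mxE [X in _ = X * _]mxE; congr (_ * _).
  under eq_bigr => k _ do rewrite [w _ _]mxE mulrCA.
  by rewrite -mulr_sumr threshold_mx_solve mulKf.
rewrite det_mulmx det_threshold_mx det_rank1_sub1 mulrCA mulrA; congr (_ * (_ - _)).
by rewrite mxE mulr_sumr; apply: eq_bigr => s _; rewrite !mxE mulrCA.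
Qed.

(** * Floor quotients *)

Lemma floor_ratio (z : int) (n : nat) : (0 < n)%N ->
  Num.floor (z%:~R / n%:R : rat) = (z %/ n%:Z)%Z.
Proof.
move=> n0; apply: floor_def; have n0' : 0 < n%:R :> rat by rewrite ltr0n.
rewrite ler_pdivlMr // ltr_pdivrMr // -[n%:R]/(n%:~R) -!intrM.
by rewrite ler_int ltr_int lez_floor ?ltz_ceil // eqz_nat -lt0n.
Qed.

(** Both families of remainders run over 0, ..., n-1, so they cancel in the difference, leaving -(1
    + ... + n) / n. *)
Lemma sum_quotients (n : nat) (a : int) (r k : 'S_n) (A B : 'I_n -> int) :
    odd n ->
    (forall j : 'I_n, a * j.+1%:Z = A j * n%:Z + (r j)%:Z) ->
    (forall j : 'I_n, (a + 1) * j.+1%:Z = B j * n%:Z + (k j)%:Z) ->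
  \sum_j A j - \sum_j B j = - n.+1./2%:Z.
Proof.
move=> n_odd hA hB; have n0 := odd_gt0 n_odd.
have nz : n%:Z != 0 by rewrite eqz_nat -lt0n.
apply: (mulIf nz).
have sumP (s : 'S_n) : \sum_j (s j)%:Z = \sum_(j < n) j%:Z.
  by rewrite [RHS](reindex_inj (@perm_inj _ s)).
have -> : (\sum_j A j - \sum_j B j) * n%:Z = - \sum_(j < n) j.+1%:Z.
  rewrite mulrBl !mulr_suml.
  under eq_bigr => j _ do rewrite -[A j * _](addrK (r j)%:Z) -hA.
  under [X in _ - X]eq_bigr => j _ do rewrite -[B j * _](addrK (k j)%:Z) -hB.
  rewrite !sumrB !sumP -!mulr_sumr; ring.
rewrite mulNr; congr (- _); rewrite -PoszM.
rewrite -(big_morph Posz PoszD (erefl 0%:Z)); congr Posz.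
rewrite -(big_mkord predT succn) -(big_add1 _ _ 0 n.+1 predT id).
have := bin2_sum n.+1; rewrite big_ltn // add0n => ->.
by rewrite bin2 /= -[in LHS](odd_double_half n.+1) /= n_odd add0n -doubleMl doubleK.
Qed.

(** This is the sum in the scalar factor of [det_rank1_sub_threshold]. Taken in the order s = k i,
    its terms become differences of consecutive members of a single sequence of powers of [q]. *)
Lemma quotient_powers_telescope (F : fieldType) (q : F) (m : nat) (a : int)
    (r k : 'S_m.+1) (A B : 'I_m.+1 -> int) (q0 : q != 0)
    (ca : coprimez m.+1 a) (cb : coprimez m.+1 (a + 1))
    (hA : forall j : 'I_m.+1, a * j.+1%:Z = A j * m.+1%:Z + (r j)%:Z)
    (hB : forall j : 'I_m.+1, (a + 1) * j.+1%:Z = B j * m.+1%:Z + (k j)%:Z) :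
  let f i := q ^ (- A ((r^-1)%g (inord i))) in
  \sum_s q ^ (B ((k^-1)%g s)) * (f s - (if s == 0 then q^-1 * f m else f s.-1))
  = q - 1.
Proof.
move=> f; set n := m.+1 in r k A B ca cb hA hB f *.
have nz : n%:Z != 0 by [].
(* [J i] is the solution of [a J = (a + 1) i] modulo [n], taken in [[0, n)] for
   [i < n] and equal to [n] for [i = n]; the two powers of [q] in the term of
   index [i] have exponents [e i.+1] and [e i]. *)
pose J (i : nat) : int :=
  if i is i'.+1 then ((r^-1)%g (k (inord i'))).+1%:Z else 0.
have hJ i : (i <= n)%N -> (n%:Z %| (a + 1) * i%:Z - a * J i)%Z.
  case: i => [|i] ilt; first by rewrite !mulr0.
  have := hB (inord i); rewrite inordK // => ->; rewrite /J hA permKV.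
  rewrite (_ : _ - _ = (B (inord i) - A ((r^-1)%g (k (inord i)))) * n%:Z).
    exact: dvdz_mull.
  by ring.
have J_ge i : 0 <= J i by case: i.
have J_lt i : (i < n)%N -> J i < n%:Z.
  case: i => // i ilt; rewrite lt_neqAle; apply/andP; split; last first.
    by rewrite /J lez_nat ltn_ord.
  apply/eqP => Jn; have := hJ i.+1 (ltnW ilt); rewrite Jn => hi.
  have : (n%:Z %| (a + 1) * i.+1%:Z)%Z.
    by rewrite -[_ * _](subrK (a * n%:Z)) rpredD // dvdz_mull.
  rewrite Gauss_dvdzr // dvdzE /=.
  by move/dvdn_leq => /(_ isT); rewrite leqNgt ilt.
have Jn : J n = n%:Z.
  have : (n%:Z %| a * J n)%Z.
    rewrite -[a * _](subKr ((a + 1) * n%:Z)) rpredB ?dvdz_mull //.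
    exact: hJ (leqnn n).
  rewrite Gauss_dvdzr // /J dvdzE /= => /dvdn_leq => /(_ isT) H.
  by congr Posz; apply/eqP; rewrite eqn_leq H ltn_ord.
pose e i := (((a + 1) * i%:Z - a * J i) %/ n%:Z)%Z.
have eP i c : (a + 1) * i%:Z - a * J i = c * n%:Z -> e i = c.
  by move=> h; rewrite /e h mulzK.
rewrite (reindex_inj (@perm_inj _ k)) /=.
(* The ends are e n = 1, because J n = n, and e 0 = 0. *)
transitivity (\sum_(i < n) (q ^ e i.+1 - q ^ e i)); last first.
  rewrite -(big_mkord predT (fun i => q ^ e i.+1 - q ^ e i)) telescope_sumr //.
  rewrite (eP n 1) ?(eP 0%N 0) ?Jn ?expr1z ?expr0z //; last by ring.
  by rewrite /=; ring.
apply: eq_bigr => i _; rewrite permK mulrBr; congr (_ - _).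
  rewrite /f inord_val -expfzDr //; congr (q ^ _); apply/esym/eP.
  by rewrite /J inord_val hA hB permKV; ring.
have Ji : (`|J i| < n)%N by rewrite -ltz_nat gez0_abs ?J_lt.
(* Modulo [n], (a + 1)(i + 1) - 1 = (a + 1) i + a = a (J i + 1), so the residue preceding [k i]
   belongs to the 0-based row index [J i]. *)
pose j2 : 'I_n := Ordinal Ji.
have j2E : j2%:Z = J i by rewrite /= gez0_abs.
have rj2 : (n%:Z %| (r j2)%:Z - ((k i)%:Z - 1))%Z.
  have -> : (r j2)%:Z = a * j2.+1%:Z - A j2 * n%:Z by rewrite hA; ring.
  have -> : (k i)%:Z = (a + 1) * i.+1%:Z - B i * n%:Z by rewrite hB; ring.
  rewrite (_ : _ - _ = (B i - A j2) * n%:Z - ((a + 1) * i%:Z - a * J i)).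
    by rewrite rpredB ?dvdz_mull // hJ // ltnW.
  by rewrite -j2E (intS i) (intS j2); ring.
have eE (c : int) : (r j2)%:Z = (k i)%:Z - 1 + c * n%:Z -> e i = B i - A j2 - c.
  move=> h; apply: eP; rewrite -j2E.
  rewrite mulrBl mulrBl (_ : B i * _ = (a + 1) * i.+1%:Z - (k i)%:Z); last by rewrite hB; ring.
  rewrite (_ : A j2 * _ = a * j2.+1%:Z - (r j2)%:Z); last by rewrite hA; ring.
  by rewrite h (intS i) (intS j2); ring.
(* When [k i] is 0 the preceding residue wraps to n - 1, which raises the exponent by one; the twist
   q^-1 compensates. *)
have [ki0|ki0] := eqVneq (k i) 0.
  have rj2E : r j2 = inord m.
    apply: ord_eq_dvdz; rewrite inordK //.
    rewrite ki0 in rj2; rewrite (_ : _ - _ = (r j2)%:Z - (0%:Z - 1) - n%:Z); first exact: rpredB.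
    by rewrite /n (intS m); ring.
  have fm : f m = q ^ (- A j2) by rewrite /f -rj2E permK.
  rewrite fm (eE 1); last by rewrite rj2E inordK // ki0 /n (intS m) /=; ring.
  by rewrite !expfzDr // exprN1; ring.
have kp : (0 < k i)%N by rewrite lt0n.
have rj2E : r j2 = inord (k i).-1.
  apply: ord_eq_dvdz; rewrite inordK; last by rewrite (leq_ltn_trans (leq_pred _)).
  by rewrite -subn1 -subzn.
have -> : f (k i).-1 = q ^ (- A j2) by rewrite /f -rj2E permK.
rewrite (eE 0) ?subr0 ?expfzDr // rj2E inordK; last by rewrite (leq_ltn_trans (leq_pred _)).
by rewrite -subn1 -subzn // mul0r addr0.
Qed.

(** * Evaluation of the determinant *)

Lemma qintD (F : fieldType) (q : F) (m1 m2 : int) : q != 0 ->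
  qint q (m1 + m2) = qint q m1 + q ^ m1 * qint q m2.
Proof. by move=> q0; rewrite /qint expfzDr //; ring. Qed.

(** [qint q] is a combination of 1 and q^m, so along a progression of step [c] it obeys the
    recurrence with roots 1 and q^c. *)
Lemma qint_arith3 (F : fieldType) (q : F) (c d : int) : q != 0 ->
  qint q (d + c + c) =
  (1 + q ^ c) * qint q (d + c) - q ^ c * qint q d.
Proof.
move=> q0; rewrite (addrC d c) (addrC (c + d) c) !(qintD _ _ c) //; ring.
Qed.

Lemma det0_row_recurrence (F : fieldType) (n : nat) (M : 'M[F]_n) (t : F)
    (i0 i1 i2 : 'I_n) : i2 != i0 -> i2 != i1 ->
    (forall k, M i2 k = (1 + t) * M i1 k - t * M i0 k) ->
  \det M = 0.
Proof.
move=> i20 i21 h; apply/eqP/det0P.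
exists (delta_mx 0 i2 - (1 + t) *: delta_mx 0 i1 + t *: delta_mx 0 i0).
  apply/eqP => /matrixP/(_ 0 i2); rewrite !mxE !eqxx (negPf i20) (negPf i21) /=.
  by rewrite !mulr0 subr0 addr0 => /eqP; rewrite oner_eq0.
apply/rowP=> k; rewrite !mulmxDl mulNmx -!scalemxAl -!rowE !mxE h; ring.
Qed.

Lemma jacobi_eq0 (a : int) (n p : nat) : (0 < n)%N -> prime p -> (p %| n)%N ->
  (p%:Z %| a)%Z -> jacobi a n = 0.
Proof.
move=> n0 p_pr pn pa; rewrite /jacobi (bigD1_seq p) ?primes_uniq //=; last first.
  by rewrite mem_primes p_pr n0 pn.
have : (0 < logn p n)%N by rewrite logn_gt0 mem_primes p_pr n0 pn.
by rewrite /legendre pa expr0n; case: (logn p n) => // l _; rewrite mul0r.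
Qed.

Lemma divz_shift (z c : int) (n : nat) : (0 < n)%N ->
  ((z + c * n%:Z) %/ n%:Z)%Z = (z %/ n%:Z)%Z + c.
Proof. by move=> n0; rewrite addrC divzMDl 1?addrC // eqz_nat -lt0n. Qed.

(** With l = n / p and a = c p, moving down [l] rows adds exactly [c] to every quotient. Since p >=
    3, rows 0, l and 2l all exist. The coefficient [b] is free so that the transposed matrix is
    covered as well. *)
Lemma det_qfloor_eq0 (F : fieldType) (q : F) (a b : int) (n p : nat) :
    q != 0 -> odd n -> prime p -> (p %| n)%N -> (p%:Z %| a)%Z ->
  \det (\matrix_(j < n, k < n)
     qint q ((a * j.+1%:Z + b * k.+1%:Z) %/ n%:Z)%Z) = 0.
Proof.
move=> q0 n_odd p_pr /dvdnP[l nE] /dvdzP[c aE]; have n0 := odd_gt0 n_odd.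
have l_odd : odd l && odd p by rewrite -oddM -nE.
case/andP: l_odd => l_odd p_odd; have l0 := odd_gt0 l_odd.
have p3 : (2 < p)%N by rewrite odd_prime_gt2.
have i1P : (l < n)%N by nia.
have i2P : (2 * l < n)%N by nia.
apply: (@det0_row_recurrence _ _ _ (q ^ c) (Ordinal n0) (Ordinal i1P) (Ordinal i2P)).
- by rewrite -val_eqE /=; lia.
- by rewrite -val_eqE /=; lia.
move=> k; rewrite !mxE /=.
have shiftE (i : nat) : a * (i + l).+1%:Z + b * k.+1%:Z =
    a * i.+1%:Z + b * k.+1%:Z + c * n%:Z.
  have -> : n%:Z = l%:Z * p%:Z by rewrite -PoszM -nE.
  by rewrite !intS PoszD aE; ring.
have -> : (2 * l = 0 + l + l)%N by lia.
by rewrite -{3}[l]add0n !shiftE !divz_shift // qint_arith3.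
Qed.

Lemma det_qfloor_coprime (F : fieldType) (q : F) (a : int) (m : nat) :
    odd m.+1 -> q != 0 -> q != 1 ->
    coprimez m.+1 a -> coprimez m.+1 (a + 1) ->
  \det (\matrix_(j < m.+1, k < m.+1)
     qint q ((a * j.+1%:Z - (a + 1) * k.+1%:Z) %/ m.+1%:Z)%Z)
  = - ((jacobi (a * (a + 1)) m.+1)%:~R * q ^ ((1 - 3 * m.+1%:Z) %/ 2)%Z).
Proof.
move=> n_odd q0 q1 ca cb; set n := m.+1.
have nz : n%:Z != 0 by [].
(* The shifts [a] and [a + 1] account for 0-based indices: a (j + 1) = a j + a. *)
have [r hr] := affine_perm_exists n a a ca.
have [k hk] := affine_perm_exists n (a + 1) (a + 1) cb.
have sgn : (jacobi (a * (a + 1)) n)%:~R = (-1) ^+ odd_perm r * (-1) ^+ odd_perm k :> F.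
  (* The composite has multiplier (a + 1) a, so Zolotarev gives the symbol of the product
     directly. *)
  have := affine_perm_comp _ _ _ _ _ _ _ hr hk => hrk.
  rewrite mulrC -(zolotarev n n_odd _ _ _ _ hrk).
    by rewrite odd_permM rmorphXn /= rmorphN1 signr_addb.
  by rewrite coprimez_sym coprimezMl ![coprimez _ n%:Z]coprimez_sym cb ca.
pose A (j : 'I_n) := ((a * j.+1%:Z - (r j)%:Z) %/ n%:Z)%Z.
pose B (j : 'I_n) := (((a + 1) * j.+1%:Z - (k j)%:Z) %/ n%:Z)%Z.
have hA (j : 'I_n) : a * j.+1%:Z = A j * n%:Z + (r j)%:Z.
  rewrite /A divzK ?subrK // -opprB rpredN intS mulrDr mulr1 (addrC a).
  exact: hr.
have hB (j : 'I_n) : (a + 1) * j.+1%:Z = B j * n%:Z + (k j)%:Z.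
  rewrite /B divzK ?subrK // -opprB rpredN intS mulrDr mulr1 [X in _ - X]addrC.
  exact: hk.
have hAB := sum_quotients n a r k A B n_odd hA hB.
have := quotient_powers_telescope F q m a r k A B q0 ca cb hA hB.
set f := fun i => _ => /= tele.
pose g (s : 'I_n) := q ^ B ((k^-1)%g s).
pose N : 'M[F]_n := \matrix_(i, s) (f i * g s - threshold_mx F q^-1 m i s).
have x1 : q^-1 != 1 by rewrite invr_eq1.
have x1' : 1 - q^-1 != 0 by rewrite subr_eq0 eq_sym.
have q1' : 1 - q != 0 by rewrite subr_eq0 eq_sym.
have qS (I : finType) (E : I -> int) : \prod_i q ^ E i = q ^ (\sum_i E i).
  by rewrite (big_morph (exprz q) (fun x y => expfzDr x y q0) (erefl _)).
(* In 1 - q^(A - B - [r < k]), taking out q^A and q^(-B) turns the 1 into the rank-one entry q^(-A)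
   q^B and the rest into a threshold entry. *)
have -> : \matrix_(j < n, i < n)
     qint q ((a * j.+1%:Z - (a + 1) * i.+1%:Z) %/ n%:Z)%Z =
   (1 - q)^-1 *: (diag_mx (\row_j q ^ A j) *m row_perm r (col_perm k N)
      *m diag_mx (\row_j q ^ (- B j))).
  apply/matrixP=> j i; rewrite [RHS]mxE mul_mx_diag mul_diag_mx !mxE.
  rewrite /f /g inord_val !permK.
  rewrite /qint mulrC; congr (_ * _).
  rewrite (_ : (_ %/ _)%Z = A j - B i - (r j < k i)%N%:Z); last first.
    rewrite hA hB (_ : _ - _ = (A j - B i - (r j < k i)%N%:Z) * n%:Z
       + ((r j)%:Z - (k i)%:Z + (r j < k i)%N%:Z * n%:Z)); last by ring.
    rewrite divzMDl // [X in _ + X]divz_small ?addr0 //.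
    have := ltn_ord (r j); have := ltn_ord (k i).
    by case: (ltnP (r j) (k i)); rewrite /= ?mul1r ?mul0r; lia.
  rewrite !expfzDr // -!invr_expz.
  have := expfz_neq0 (A j) q0; have := expfz_neq0 (B i) q0.
  move: (q ^ A j) (q ^ B i) => y z z0 y0.
  case: (r j < k i)%N; rewrite /= ?expr1z ?expr0z.
    by field; rewrite z0 q0 y0.
  by rewrite divr1 mulrBr mulr1 mulVKf // mulrBl divff.
rewrite detZ !det_mulmx !det_diag row_permE col_permE !det_mulmx !det_perm odd_permV.
have rowS (E : 'I_n -> int) : \prod_i (\row_j q ^ E j) 0 i = q ^ (\sum_i E i).
  by rewrite -qS; apply: eq_bigr => i _; rewrite mxE.
rewrite !rowS sumrN det_rank1_sub_threshold // tele sgn.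
have [h hE] : exists h, m = h.*2.
  by exists m./2; rewrite -[LHS]odd_double_half; move: n_odd => /= /negPf ->.
have nE : n.+1./2%:Z = h%:Z + 1 by rewrite /n hE /= doubleK -addn1 PoszD.
(* The exponent is -(n + 1) / 2 from the diagonal scalings plus -(n - 1) from (1 - q^-1)^(n - 1). *)
have expE : ((1 - 3 * n%:Z) %/ 2)%Z = (\sum_j A j - \sum_j B j) - h.*2%:Z.
  rewrite hAB nE (_ : 1 - _ = (- (h%:Z + 1) - h.*2%:Z) * 2) ?mulzK //.
  by rewrite /n hE (intS h.*2) -muln2 PoszM; ring.
rewrite expE !expfzDr // -!invr_expz -exprnP.
rewrite (_ : 1 - (1 - q^-1)^-1 * (q - 1) = 1 - q); last by field; rewrite q0 subr_eq0 q1.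
(* As [m] is even, the sign between q - 1 and 1 - q disappears. *)
have xE : (1 - q^-1) ^+ m = (1 - q) ^+ m / q ^+ h.*2.
  rewrite hE -mul2n !exprM -exprVn -exprMn; congr (_ ^+ _).
  by field.
have sE : (-1) ^+ m.+1 = -1 :> F by rewrite exprS -signr_odd hE odd_double mulr1.
rewrite sE xE /n exprS exprVn.
have := expf_neq0 m q1'; have := expf_neq0 h.*2 q0; have := expfz_neq0 (\sum_j B j) q0.
move: (q ^ \sum_j A j) (q ^ \sum_j B j) ((1 - q) ^+ m) (q ^+ h.*2) => y z u v z0 v0 u0.
move: ((-1) ^+ odd_perm r) ((-1) ^+ odd_perm k) (1 - q) q1' => e1 e2 d d0.
by field; rewrite u0 v0 z0 d0.
Qed.

Theorem theorem1p1 (R : fieldType) (q : R) (a : int) (n : nat)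
  (hn0 : (0 < n)%N) (hnodd : odd n) (hq0 : q != 0) (hq1 : q != 1) :
  \det (\matrix_(j < n, k < n)
          qint q (Num.floor (((a * (j.+1)%:Z - (a + 1) * (k.+1)%:Z)%:~R
                               / n%:R : rat))))
  = - ((jacobi (a * (a + 1)) n)%:~R * q ^ ((1 - 3 * n%:Z) %/ 2)%Z).
Proof.
transitivity (\det (\matrix_(j < n, k < n)
    qint q ((a * j.+1%:Z - (a + 1) * k.+1%:Z) %/ n%:Z)%Z)).
  by congr (\det _); apply/matrixP=> j k; rewrite !mxE floor_ratio.
have primeP (b : int) : ~~ coprimez n b ->
    exists p, [/\ prime p, (p %| n)%N & (p%:Z %| b)%Z].
  rewrite coprimezE /coprime => ng1; exists (pdiv (gcdn n `|b|)).
  have g1 : (1 < gcdn n `|b|)%N by rewrite ltn_neqAle eq_sym ng1 gcdn_gt0 hn0.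
  have := pdiv_dvd (gcdn n `|b|); rewrite dvdn_gcd => /andP[pn pb].
  by rewrite pdiv_prime.
have [ca|/primeP[p [p_pr pn pa]]] := boolP (coprimez n a); last first.
  rewrite (jacobi_eq0 _ _ p) ?dvdz_mulr // mul0r oppr0.
  rewrite -[RHS](det_qfloor_eq0 _ q a (- (a + 1)) n p hq0 hnodd p_pr pn pa).
  by congr (\det _); apply/matrixP=> j k; rewrite !mxE mulNr.
have [cb|/primeP[p [p_pr pn pb]]] := boolP (coprimez n (a + 1)); last first.
  rewrite (jacobi_eq0 _ _ p) ?dvdz_mull // mul0r oppr0.
  (* Transposing exchanges the roles of [a] and [-(a + 1)], so the column recurrence becomes a row
     recurrence. *)
  have pNb : (p%:Z %| - (a + 1))%Z by rewrite rpredN.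
  rewrite -[RHS](det_qfloor_eq0 _ q _ a n p hq0 hnodd p_pr pn pNb) -det_tr.
  by congr (\det _); apply/matrixP=> j k; rewrite !mxE mulNr addrC.
case: n hn0 hnodd ca cb {primeP} => // m _ m_odd ca cb.
exact: det_qfloor_coprime.
Qed.
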